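(* Let $D$ be an integral domain that is not a field. For an ideal $Q$ of $D$: $Q$ is a maximal $t$-ideal of $D$ if and only if $Q = M \cap D$ for some $M \in \mathrm{Max}(\mathrm{Na}(D,v))$.
   Context: $D$ is an integral domain with quotient field $K$. For a nonzero $D$-submodule $E$ of $K$, $E^{-1} := \{z \in K \mid zE \subseteq D\}$ and $E^v := (E^{-1})^{-1}$; the $t$-operation is $E^t := \bigcup\{F^v \mid F \subseteq E,\ F \text{ a nonzero finitely generated } D\text{-submodule of } K\}$. A $t$-ideal of $D$ is a nonzero ideal $I\subseteq D$ with $I^t = I$; a maximal $t$-ideal is a maximal element of the set of all proper $t$-ideals of $D$. For a polynomial $h \in D[X]$, $\boldsymbol{c}(h)$ is the ideal of $D$ generated by the coefficients of $h$. $\mathrm{Na}(D,v) := \{f/g \mid f,g \in D[X],\ g \neq 0,\ \boldsymbol{c}(g)^v = D\}$, the Nagata ring of $D$ with respect to $v$ (a subring of $K(X)$). *)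

(* Defs.v *)
From HB Require Import structures.
From mathcomp Require Import all_boot all_order all_algebra.
From mathcomp Require Import boolp classical_sets.

Set Implicit Arguments.
Unset Strict Implicit.
Unset Printing Implicit Defensive.

Import GRing.Theory.
Local Open Scope classical_set_scope.
Local Open Scope ring_scope.

(* S plays the role of a subring of L; closure under opposites then follows
   from closure under scaling by -1. *)
Definition is_submodule (L : comNzRingType) (S E : set L) : Prop :=
  [/\ E 0, (forall x y, E x -> E y -> E (x + y))
    & forall a x, S a -> E x -> E (a * x)].

Definition is_ideal (L : comNzRingType) (S I : set L) : Prop :=
  I `<=` S /\ is_submodule S I.

Definition maximal_among (T : Type) (P : set T -> Prop) (A : set T) : Prop :=
  P A /\ forall B, P B -> A `<=` B -> B = A.

Definition is_maximal_ideal (L : comNzRingType) (S : set L) : set L -> Prop :=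
  maximal_among (fun I => is_ideal S I /\ I <> S).

Section StarOperations.
Variable D : idomainType.

Definition D_in_K : set {fraction D} := range (@tofrac D).

Definition ext (I : set D) : set {fraction D} := @tofrac D @` I.

Definition inv_module (E : set {fraction D}) : set {fraction D} :=
  [set z | forall x, E x -> D_in_K (z * x)].

Definition v_op (E : set {fraction D}) : set {fraction D} :=
  inv_module (inv_module E).

Definition is_fg_submodule (F : set {fraction D}) : Prop :=
  exists s : seq {fraction D}, F = smallest (is_submodule D_in_K) [set` s].

Definition t_op (E : set {fraction D}) : set {fraction D} :=
  \bigcup_(F in [set F | [/\ is_fg_submodule F, F <> [set 0] & F `<=` E]])
    v_op F.

Definition is_t_ideal (I : set D) : Prop :=
  [/\ is_ideal setT I, I <> [set 0] & t_op (ext I) = ext I].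

Definition is_maximal_t_ideal : set D -> Prop :=
  maximal_among (fun I => is_t_ideal I /\ I <> setT).

Definition content (h : {poly D}) : set D :=
  smallest (is_ideal setT) [set` polyseq h].

Definition polyDK (h : {poly D}) : {fraction {poly {fraction D}}} :=
  tofrac (map_poly (@tofrac D) h).

Definition Na_v : set {fraction {poly {fraction D}}} :=
  [set z | exists f g : {poly D},
     [/\ g <> 0, v_op (ext (content g)) = D_in_K & z = polyDK f / polyDK g]].

Definition contract (M : set {fraction {poly {fraction D}}}) : set D :=
  [set a | M (polyDK a%:P)].

End StarOperations.

(* Main.v *)
Require Import Defs.
From HB Require Import structures.
From mathcomp Require Import all_boot all_order all_algebra.
From mathcomp Require Import boolp classical_sets.
From mathcomp Require Import ring.

Set Implicit Arguments.
Unset Strict Implicit.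
Unset Printing Implicit Defensive.

Import GRing.Theory.
Local Open Scope classical_set_scope.
Local Open Scope ring_scope.

(** Every maximal ideal of the Nagata ring turns out to be extended from a
    t-ideal of D.  Call a polynomial g superprimitive when c(g)^v = D; the
    Nagata ring is D[X] localized at the superprimitive polynomials, which
    form a multiplicative set by a McCoy-type argument modulo the nonzero
    elements of D ([superprimitive_cancel]).

    Two constructions compare ideals of D with ideals of the Nagata ring.
    - An ideal J of D is extended to N(J), the fractions f/g with f in J[X]
      and g superprimitive ([nagata_ext]).  If J is a t-ideal, then
      N(J) contracts back to J, since a * g in J[X] forces
      a to lie in (a c(g))^v, hence in J ([contract_nagata_ext]).
    - An ideal B of the Nagata ring yields its t-content J(B), the union of
      the c(h)^v over the polynomials h in B ([t_content]).  That union is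
      directed, because h1 + X^n h2 has all the coefficients of h1 and h2 as
      soon as n is large; so J(B) is an ideal closed under the t-operation,
      and a t-ideal when B is nonzero ([t_content_t_ideal]).  It is proper
      when B is, for 1 in c(h)^v makes h a unit of the Nagata ring.
    By construction B is contained in N(J(B)).

    If Q is a maximal t-ideal, a proper ideal B containing N(Q) has a proper
    t-ideal J(B) containing Q as t-content, so J(B) = Q and B = N(Q): thus
    N(Q) is maximal, and it lies over Q.  Conversely a maximal ideal M equals
    N(J(M)), so it lies over the t-ideal J(M), and a larger proper t-ideal
    would extend to a larger proper ideal of the Nagata ring.  That D is not
    a field enters through M <> 0, which makes J(M) nonzero, and through the
    zero polynomial, whose content satisfies c(0)^v <> D. *)

(** * Divisibility and superprimitive polynomials *)

Definition divides {R : comNzRingType} (b x : R) : Prop := exists q, x = b * q.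

Lemma divides0 (R : comNzRingType) (b : R) : divides b 0.
Proof. by exists 0; rewrite mulr0. Qed.

Lemma dividesD (R : comNzRingType) (b x y : R) :
  divides b x -> divides b y -> divides b (x + y).
Proof. by move=> [p ->] [q ->]; exists (p + q); ring. Qed.

Lemma dividesMl (R : comNzRingType) (b x y : R) :
  divides b y -> divides b (x * y).
Proof. by move=> [q ->]; exists (x * q); ring. Qed.

Lemma dividesB (R : comNzRingType) (b x y : R) :
  divides b x -> divides b y -> divides b (x - y).
Proof. by move=> [p ->] [q ->]; exists (p - q); ring. Qed.

Lemma divides_polyC (R : comNzRingType) (b : R) (f : {poly R}) :
  divides b%:P f <-> forall i, divides b f`_i.
Proof.
split=> [[q ->] i|/choice[q qE]]; first by exists q`_i; rewrite coefCM.
exists (\poly_(i < size f) q i); apply/polyP => i.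
rewrite coefCM coef_poly; case: ltnP => [_|le_f_i]; first exact: qE.
by rewrite mulr0 nth_default.
Qed.

(** This is membership of a in c(f)^v, written without fractions: the fraction
    c / b multiplies c(f) into D exactly when b divides each c * f`_i. *)
Definition content_v {D : idomainType} (f : {poly D}) : set D :=
  [set a | forall b c, b != 0 -> (forall i, divides b (c * f`_i)) ->
                       divides b (c * a)].

Definition superprimitive {D : idomainType} (g : {poly D}) : Prop :=
  content_v g 1.

Section ContentV.
Variable D : idomainType.
Implicit Types (a b c : D) (f g h k : {poly D}).

Lemma content_v_coef f i : content_v f f`_i.
Proof. by move=> b c _; apply. Qed.

Lemma content_v_trans f g a :
  (forall i, content_v g f`_i) -> content_v f a -> content_v g a.
Proof. by move=> sub_fg fa b c nzb dvd_g; apply: fa => // i; apply: sub_fg. Qed.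

Lemma content_vM f x a : content_v f a -> content_v f (x * a).
Proof.
move=> fa b c nzb /(fa b c nzb) dvd_a.
by rewrite mulrCA; apply: dividesMl.
Qed.

(** The content of h := f + X^n g with n = size f is c(f) + c(g), since no two
    coefficients overlap. *)
Lemma content_v_join f g :
  let h := f + 'X^(size f) * g in
  (forall a, content_v f a -> content_v h a) /\
  (forall a, content_v g a -> content_v h a).
Proof.
split=> a; apply: content_v_trans => i b c _ dvd_h.
  case: (ltnP i (size f)) => [lt_i_f|le_f_i]; last first.
    by rewrite nth_default // mulr0; apply: divides0.
  by have:= dvd_h i; rewrite coefD coefXnM lt_i_f addr0.
have:= dvd_h (i + size f)%N.
by rewrite coefD coefXnM ltnNge leq_addl /= addnK nth_default ?leq_addl ?add0r.
Qed.

(** McCoy's argument in (D/b)[X]: if h * f vanishes modulo b, then every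
    coefficient of k kills f modulo b as soon as k * f vanishes modulo b, by
    descending induction on the degrees of f and k.  For k = h this gives
    b | h`_j * f`_i for all i, j, and superprimitivity of h removes h`_j. *)
Lemma superprimitive_cancel h b f : superprimitive h -> b != 0 ->
  divides b%:P (f * h) -> divides b%:P f.
Proof.
move=> h_prim nzb; move: {2}(size f) (leqnn (size f)) => m.
elim: m f => [|m IHm] f le_f_m dvd_fh.
  move: le_f_m; rewrite leqn0 size_poly_eq0 => /eqP->; exact: divides0.
have dvd_kf n k : (size k <= n)%N -> divides b%:P (f * k) ->
    forall j, divides b%:P ((k`_j)%:P * f).
  elim: n k => [|n IHn] k le_k_n dvd_fk j.
    by rewrite nth_default ?mul0r ?(leq_trans le_k_n) //; apply: divides0.
  have dvd_lead : divides b (k`_n * f`_m).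
    have/divides_polyC/(_ (m + n)%N) := dvd_fk.
    (* f`_m * k`_n is the only product contributing to degree m + n *)
    rewrite coefM (bigD1 (inord m)) //= inordK ?ltnS ?leq_addr // addKn.
    rewrite big1 ?addr0 1?mulrC // => i.
    rewrite -val_eqE /= inordK ?ltnS ?leq_addr //.
    move=> ne_i_m; case: (ltnP m i) => [lt_m_i|le_i_m].
      by rewrite nth_default ?mul0r // (leq_trans le_f_m).
    rewrite [k`_ _]nth_default ?mulr0 // (leq_trans le_k_n) //.
    by rewrite ltn_subRL ltn_add2r ltn_neqAle ne_i_m.
  have dvd_n : divides b%:P ((k`_n)%:P * f).
    pose f' := f - (f`_m)%:P * 'X^m.
    have le_f'_m : (size ((k`_n)%:P * f')%R <= m)%N.
      apply/leq_sizeP => i le_m_i; rewrite coefCM coefB coefCM coefXn.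
      case: ltngtP le_m_i => // [lt_m_i|->] _; last by rewrite mulr1 subrr mulr0.
      by rewrite mulr0 subr0 [f`__]nth_default ?mulr0 // (leq_trans le_f_m).
    have dvd_leadP : divides b%:P (k`_n * f`_m)%:P.
      by case: dvd_lead => q ->; exists q%:P; rewrite polyCM.
    have ->: (k`_n)%:P * f = (k`_n)%:P * f' + 'X^m * (k`_n * f`_m)%:P.
      by rewrite /f' polyCM; ring.
    apply: dividesD; last exact: dividesMl.
    apply: IHm => //.
    have ->: (k`_n)%:P * f' * h
        = (k`_n)%:P * (f * h) - ('X^m * h) * (k`_n * f`_m)%:P.
      by rewrite /f' polyCM; ring.
    by apply: dividesB; apply: dividesMl.
  pose k' := k - (k`_n)%:P * 'X^n.
  have k'E i : k'`_i = if i == n then 0 else k`_i.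
    rewrite coefB coefCM coefXn.
    by case: eqP => [->|_]; rewrite ?mulr1 ?subrr // mulr0 subr0.
  have [->//|ne_j_n] := eqVneq j n.
  have <-: k'`_j = k`_j by rewrite k'E (negPf ne_j_n).
  apply: IHn.
    apply/leq_sizeP => i le_n_i; rewrite k'E; case: eqP => // /eqP ne_i_n.
    by rewrite nth_default // (leq_trans le_k_n) // ltn_neqAle eq_sym ne_i_n.
  have ->: f * k' = f * k - 'X^n * ((k`_n)%:P * f) by rewrite /k'; ring.
  by apply: dividesB => //; apply: dividesMl.
apply/divides_polyC => i; rewrite -[f`_i]mulr1.
apply: h_prim => // j; rewrite mulrC -coefCM.
by have/divides_polyC := dvd_kf _ h (leqnn _) dvd_fh j.
Qed.

Lemma superprimitiveM g h :
  superprimitive g -> superprimitive h -> superprimitive (g * h).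
Proof.
move=> g_prim h_prim b c nzb dvd_gh; apply: g_prim => // i.
rewrite -coefCM; move: i; apply/divides_polyC.
apply: superprimitive_cancel h_prim nzb _; apply/divides_polyC => i.
by rewrite -mulrA coefCM.
Qed.

Lemma superprimitive1 : superprimitive (1 : {poly D}).
Proof. by move=> b c _ /(_ 0%N); rewrite coef1. Qed.

Lemma superprimitive_neq0 g :
  ~ GRing.field_axiom D -> superprimitive g -> g != 0.
Proof.
move=> D_not_field g_prim; apply/eqP => g0; apply: D_not_field => b nzb.
have [i|q] := g_prim b 1 nzb; first by rewrite g0 coef0 mulr0; apply: divides0.
by rewrite mulr1 => /esym eq1; apply/unitrPr; exists q.
Qed.

End ContentV.

(** * Divisorial closures in terms of polynomial contents *)

Section Closures.
Variable D : idomainType.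
Local Notation iota := (@tofrac D).
Implicit Types (a b c : D) (f g : {poly D}) (E : set {fraction D}).

Lemma tofrac_inj (R : idomainType) : injective (@tofrac R).
Proof. by move=> x y /eqP; rewrite tofrac_eq => /eqP. Qed.

Lemma fraction_tofrac (R : idomainType) (z : {fraction R}) :
  exists c b : R, b != 0 /\ z = tofrac c / tofrac b.
Proof.
elim/quotW: z => x; exists \n_x, \d_x; split; first exact: denom_ratioP.
have nzd : tofrac \d_x != 0 by rewrite tofrac_eq0 denom_ratioP.
apply: (mulIf nzd); rewrite mulfVK //; unlock FracField.tofrac.
rewrite -[LHS]FracField.pi_mul; apply/eqmodP.
by rewrite /= /FracField.equivf /FracField.mulf /= !numden_Ratio
  ?mulf_neq0 ?denom_ratioP ?oner_neq0 // !mulr1 mulrC.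
Qed.

Lemma D_in_K_frac c b x : b != 0 ->
  D_in_K (iota c / iota b * iota x) <-> divides b (c * x).
Proof.
move=> nzb; have nzb' : iota b != 0 by rewrite tofrac_eq0.
split=> [[q _ qE]|[q qE]]; exists q => //.
  by apply: tofrac_inj; rewrite !tofracM qE mulrAC [RHS]mulrC mulfVK.
by apply: (mulIf nzb'); rewrite mulrAC mulfVK // -!tofracM qE mulrC.
Qed.

Lemma D_in_KD (x y : {fraction D}) : D_in_K x -> D_in_K y -> D_in_K (x + y).
Proof. by move=> [a _ <-] [b _ <-]; exists (a + b); rewrite ?tofracD. Qed.

Lemma D_in_KM (x y : {fraction D}) : D_in_K x -> D_in_K y -> D_in_K (x * y).
Proof. by move=> [a _ <-] [b _ <-]; exists (a * b); rewrite ?tofracM. Qed.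

Lemma D_in_K0 : D_in_K (0 : {fraction D}).
Proof. by exists 0; rewrite ?tofrac0. Qed.

(** Whatever its generators are, a module with the same inverse as c(f) has
    divisorial closure c(f)^v; the closure stays inside D because 1 belongs to
    that inverse. *)
Lemma v_op_content_v E f :
    (forall z, inv_module E z <-> forall i, D_in_K (z * iota f`_i)) ->
  v_op E = iota @` content_v f.
Proof.
move=> invE; apply/seteqP; split=> [w Ew|_ [a fa <-] z /invE fz] /=.
  have [|a _ aE] := Ew 1.
    by apply/invE => i; rewrite mul1r; exists f`_i.
  exists a; last by rewrite aE mulr1.
  move=> b c nzb dvd_f; apply/D_in_K_frac => //.
  rewrite aE mulr1 mulrC; apply: Ew; apply/invE => i.
  exact/D_in_K_frac.
have [c [b [nzb zE]]] := fraction_tofrac z; rewrite mulrC zE.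
apply/D_in_K_frac => //; apply: fa => // i.
by apply/D_in_K_frac => //; rewrite -zE.
Qed.

Lemma inv_module_content f z :
  inv_module (ext (content f)) z <-> forall i, D_in_K (z * iota f`_i).
Proof.
split=> [Ez i|fz _ [a fa <-]].
  apply: Ez; exists f`_i => // I [[_ [I0 _ _]] sfI].
  case: (ltnP i (size f)) => [lt_i_f|le_f_i]; last by rewrite nth_default.
  by apply: sfI; apply: mem_nth.
apply: (fa [set x | D_in_K (z * iota x)]); split.
  split=> //; split=> [|x y|x y _] /=.
  - by rewrite tofrac0 mulr0; apply: D_in_K0.
  - by rewrite tofracD mulrDr; apply: D_in_KD.
  - by rewrite tofracM mulrCA => ?; apply: D_in_KM => //; exists x.
by move=> _ /(nthP 0)[i _ <-]; apply: fz.
Qed.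

Lemma v_op_ext_content f :
  v_op (ext (content f)) = @D_in_K D <-> superprimitive f.
Proof.
rewrite (v_op_content_v (inv_module_content f)); split=> [eqD|f_prim].
  have: (iota @` content_v f) (iota 1) by rewrite eqD; exists 1.
  by case=> x fx /tofrac_inj x1; rewrite /superprimitive -x1.
apply/seteqP; split=> [_ [a _ <-]|_ [a _ <-]]; exists a => //.
by rewrite -[a]mulr1; apply: content_vM.
Qed.

Definition span_D (s : seq D) : set {fraction D} :=
  smallest (is_submodule (@D_in_K D)) [set` map iota s].

Lemma v_op_span (s : seq D) :
  v_op (span_D s) = iota @` content_v (Poly s).
Proof.
apply: v_op_content_v => z; split=> [Ez i|sz x sx].
  apply: Ez => A [[A0 _ _] sA]; rewrite coef_Poly.
  case: (ltnP i (size s)) => [lt_i_s|le_s_i]; last first.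
    by rewrite nth_default ?tofrac0.
  by apply: sA; apply: map_f; apply: mem_nth.
apply: (sx [set x | D_in_K (z * x)]); split.
  split=> [|u v|u v] /=.
  - by rewrite mulr0; apply: D_in_K0.
  - by rewrite mulrDr; apply: D_in_KD.
  - by rewrite mulrCA; apply: D_in_KM.
move=> _ /mapP[a /(nthP 0)[i _ <-] ->]; rewrite /= -coef_Poly; exact: sz.
Qed.

Lemma span_sub_ext (s : seq D) (I : set D) :
  is_ideal setT I -> (forall i, I s`_i) -> span_D s `<=` ext I.
Proof.
move=> [_ [I0 ID IM]] sI; apply: smallest_sub.
  split=> [|_ _ [x Ix <-] [y Iy <-]|_ _ [x _ <-] [y Iy <-]].
  - by exists 0; rewrite ?tofrac0.
  - by exists (x + y); rewrite ?tofracD //; apply: ID.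
  - by exists (x * y); rewrite ?tofracM //; apply: IM.
by move=> _ /mapP[a /(nthP 0)[i _ <-] ->]; exists s`_i.
Qed.

Lemma span_neq0 (s : seq D) i : s`_i != 0 -> span_D s <> [set 0].
Proof.
move=> nzs eq0; have: span_D s (iota s`_i).
  move=> A [_ sA]; apply: sA; apply: map_f; apply: mem_nth.
  by rewrite ltnNge; apply: contraNN nzs => le_s_i; rewrite nth_default.
by rewrite eq0 => /eqP; rewrite tofrac_eq0 (negPf nzs).
Qed.

Lemma ideal_neq0 (I : set D) : is_ideal setT I -> I <> [set 0] ->
  exists2 y, I y & y != 0.
Proof.
move=> [_ [I0 _ _]] nzI; apply: contrapT => noy; apply: nzI.
apply/seteqP; split=> [x Ix|_ ->] //=.
by apply/eqP; apply: contrapT => /negP nzx; apply: noy; exists x.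
Qed.

(** Every finitely generated submodule of I is generated by the coefficients of
    some polynomial over I, so polynomials replace the modules F in I^t. *)
Lemma t_idealP (I : set D) : is_ideal setT I -> I <> [set 0] ->
  is_t_ideal I <->
  forall f a, (forall i, I f`_i) -> content_v f a -> I a.
Proof.
move=> idI nzI; have [y Iy nzy] := ideal_neq0 idI nzI.
split=> [[_ _ tI] f a If fa|It].
  (* prepending y keeps the generated module nonzero even if f = 0 *)
  have: ext I (iota a); last by case=> x Ix /tofrac_inj <-.
  rewrite -tI; exists (span_D (y :: f)); last first.
    rewrite v_op_span; exists a => //.
    apply: content_v_trans fa => i.
    have ->: f`_i = (Poly (y :: f))`_i.+1 by rewrite coef_Poly.
    exact: content_v_coef.
  split; first by exists (map iota (y :: f)).
    exact: (@span_neq0 _ 0).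
  by apply: span_sub_ext => // -[|i] //=.
split=> //; apply/seteqP; split=> [w [F [[s FE] _ sFI]]|_ [x Ix <-]].
  have sI u : u \in s -> exists2 x, I x & iota x = u.
    by move=> su; apply: sFI; rewrite FE => A [_]; apply.
  have [s' Is' sE] : exists2 s' : seq D, forall i, I s'`_i & s = map iota s'.
    elim: s sI {FE} => [|u s IHs] sI.
      by exists [::] => // i; rewrite nth_nil; case: idI => _ [].
    have [x Ix xE] := sI u (mem_head _ _).
    have [|s' Is' sE] := IHs; first by move=> v sv; apply: sI; rewrite inE sv orbT.
    by exists (x :: s'); [case | rewrite /= xE sE].
  rewrite FE sE v_op_span => -[a fa <-]; exists a => //.
  by apply: It fa => i; rewrite coef_Poly.
exists (span_D [:: y; x]).
  split; first by exists (map iota [:: y; x]).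
    exact: (@span_neq0 _ 0).
  by apply: span_sub_ext => // -[|[|i]] //=; rewrite nth_nil; case: idI => _ [].
rewrite v_op_span; exists x => //.
have {2}->: x = (Poly [:: y; x])`_1 by rewrite coef_Poly.
exact: content_v_coef.
Qed.

End Closures.

(** * Extension to the Nagata ring and t-contents *)

Section Nagata.
Variable D : idomainType.
Hypothesis D_not_field : ~ GRing.field_axiom D.
Implicit Types (a b c : D) (f g h : {poly D}) (J : set D).
Implicit Types B : set {fraction {poly {fraction D}}}.
Local Notation phi := (@polyDK D).
Local Notation Na := (@Na_v D).

Lemma polyDKD f g : phi (f + g) = phi f + phi g.
Proof. by rewrite /polyDK !rmorphD. Qed.

Lemma polyDKM f g : phi (f * g) = phi f * phi g.
Proof. by rewrite /polyDK !rmorphM. Qed.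

Lemma polyDK0 : phi 0 = 0.
Proof. by rewrite /polyDK !rmorph0. Qed.

Lemma polyDK1 : phi 1 = 1.
Proof. by rewrite /polyDK !rmorph1. Qed.

Lemma polyDK_inj : injective phi.
Proof.
by move=> f g /tofrac_inj; apply: map_inj_poly; [apply: tofrac_inj | rewrite tofrac0].
Qed.

Lemma polyDK_neq0 g : superprimitive g -> phi g != 0.
Proof.
move/(superprimitive_neq0 D_not_field); apply: contraNneq => g0.
by apply/eqP/polyDK_inj; rewrite g0 polyDK0.
Qed.

Definition nagata_ext J : set {fraction {poly {fraction D}}} :=
  [set z | exists f g, [/\ forall i, J f`_i, superprimitive g
                         & z = phi f / phi g]].

Definition t_content B : set D :=
  [set a | exists2 h, B (phi h) & content_v h a].

Lemma Na_vE : Na = nagata_ext setT.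
Proof.
apply/seteqP; split=> z [f [g]].
  by case=> nzg /v_op_ext_content g_prim ->; exists f, g.
case=> _ g_prim ->; exists f, g; split=> //; last exact/v_op_ext_content.
by apply/eqP/superprimitive_neq0.
Qed.

Lemma nagata_extS J J' : J `<=` J' -> nagata_ext J `<=` nagata_ext J'.
Proof. by move=> sJJ' z [f [g [Jf ? ->]]]; exists f, g; split=> // i; apply: sJJ'. Qed.

Lemma nagata_ext_polyDK J f : (forall i, J f`_i) -> nagata_ext J (phi f).
Proof.
by move=> Jf; exists f, 1; split=> //; rewrite ?polyDK1 ?divr1 //; apply: superprimitive1.
Qed.

Lemma Na_polyDK f : Na (phi f).
Proof. by rewrite Na_vE; apply: nagata_ext_polyDK. Qed.

Lemma Na_superprimitiveV g : superprimitive g -> Na (phi g)^-1.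
Proof.
by move=> g_prim; rewrite Na_vE; exists 1, g; split=> //; rewrite polyDK1 mul1r.
Qed.

Lemma coefM_ideal J f g : is_ideal setT J -> (forall i, J g`_i) ->
  forall i, J (f * g)`_i.
Proof.
move=> [_ [J0 JD JM]] Jg i; rewrite coefM.
by elim/big_ind: _ => // j _; apply: JM.
Qed.

Lemma coefD_ideal J f g : is_ideal setT J -> (forall i, J f`_i) ->
  (forall i, J g`_i) -> forall i, J (f + g)`_i.
Proof. by move=> [_ [_ JD _]] Jf Jg i; rewrite coefD; apply: JD. Qed.

Lemma nagata_ext_ideal J : is_ideal setT J -> is_ideal Na (nagata_ext J).
Proof.
move=> idJ; split; first by rewrite Na_vE; apply: nagata_extS.
split.
- rewrite -polyDK0; apply: nagata_ext_polyDK => i; rewrite coef0.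
  by case: idJ => _ [].
- move=> _ _ [f [g [Jf pg ->]]] [f' [g' [Jf' pg' ->]]].
  exists (g' * f + g * f'), (g * g'); split; last 1 first.
  + rewrite addf_div ?polyDK_neq0 // polyDKD !polyDKM.
    by rewrite (mulrC (phi f)) (mulrC (phi f')).
  + by apply: coefD_ideal => //; apply: coefM_ideal.
  + exact: superprimitiveM.
- rewrite Na_vE => _ _ [f [g [_ pg ->]]] [f' [g' [Jf' pg' ->]]].
  exists (f * f'), (g * g'); split; last 1 first.
  + by rewrite mulf_div !polyDKM.
  + exact: coefM_ideal.
  + exact: superprimitiveM.
Qed.

(** If a = f / g with f in J[X], then J contains the coefficients of a * g, and
    a belongs to (a c(g))^v = a D because g is superprimitive. *)
Lemma contract_nagata_ext J : is_ideal setT J -> is_t_ideal J ->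
  contract (nagata_ext J) = J.
Proof.
move=> idJ tJ; have [_ nzJ _] := tJ.
have Jt := (t_idealP idJ nzJ).1 tJ.
apply/seteqP; split=> [a [f [g [Jf g_prim aE]]]|a Ja]; last first.
  apply: nagata_ext_polyDK => i; rewrite coefC.
  by case: (i == _) => //; case: idJ => _ [].
have {aE} fE : f = a%:P * g.
  by apply: polyDK_inj; rewrite polyDKM aE mulfVK // polyDK_neq0.
apply: (Jt (a%:P * g)) => [i|b c nzb dvd_ag]; first by rewrite -fE.
rewrite -[c * a]mulr1; apply: g_prim => // i.
by rewrite -mulrA -coefCM.
Qed.

Lemma nagata_ext_proper J : is_t_ideal J -> J <> setT -> nagata_ext J <> Na.
Proof.
move=> tJ ntJ eqNa; apply: ntJ; have [idJ _ _] := tJ.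
rewrite -(contract_nagata_ext idJ tJ); apply/seteqP; split=> // a _.
rewrite /contract /= eqNa; exact: Na_polyDK.
Qed.

Lemma ideal_Na_1 B : is_ideal Na B -> B 1 -> B = Na.
Proof.
move=> [sB [_ _ BM]] B1; apply/seteqP; split=> // z Nz.
by rewrite -[z]mulr1; apply: BM.
Qed.

Lemma t_content_proper B : is_ideal Na B -> B <> Na -> t_content B <> setT.
Proof.
move=> idB ntB eqT; apply: ntB; apply: ideal_Na_1 => //.
have [h Bh h_prim] : t_content B 1 by rewrite eqT.
have [_ [_ _ BM]] := idB.
by rewrite -(mulVf (polyDK_neq0 h_prim)); apply: BM => //; apply: Na_superprimitiveV.
Qed.

Lemma nagata_ext_t_content B : is_ideal Na B -> B `<=` nagata_ext (t_content B).
Proof.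
move=> [sB [_ _ BM]] z Bz; have:= sB _ Bz; rewrite Na_vE => -[f [g [_ pg zE]]].
exists f, g; split=> // i; exists f; last exact: content_v_coef.
have ->: phi f = phi g * z by rewrite zE mulrC mulfVK ?polyDK_neq0.
by apply: BM => //; apply: Na_polyDK.
Qed.

Lemma sub_t_content B J : is_ideal setT J -> nagata_ext J `<=` B ->
  J `<=` t_content B.
Proof.
move=> [_ [J0 _ _]] sJB a Ja; exists a%:P; last first.
  by have:= @content_v_coef _ a%:P 0; rewrite coefC.
by apply: sJB; apply: nagata_ext_polyDK => i; rewrite coefC; case: (i == _).
Qed.

Lemma ideal_polyDK_join B f g : is_ideal Na B -> B (phi f) -> B (phi g) ->
  B (phi (f + 'X^(size f) * g)).
Proof.
move=> [_ [_ BD BM]] Bf Bg; rewrite polyDKD polyDKM.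
by apply: BD => //; apply: BM => //; apply: Na_polyDK.
Qed.

Lemma t_content_ideal B : is_ideal Na B -> is_ideal setT (t_content B).
Proof.
move=> idB; split=> //; split.
- exists 0; first by rewrite polyDK0; case: idB => _ [].
  by have:= @content_v_coef _ (0 : {poly D}) 0; rewrite coef0.
- move=> x y [f Bf fx] [g Bg gy]; have [sf sg] := content_v_join f g.
  exists (f + 'X^(size f) * g); first exact: ideal_polyDK_join.
  move=> b c nzb dvd_h; rewrite mulrDr.
  by apply: dividesD; [apply: (sf x) | apply: (sg y)].
- by move=> x a _ [f Bf fa]; exists f => //; apply: content_vM.
Qed.

(** The sets c(h)^v, for h in B, form a directed family, so finitely many
    elements of the union lie in a single one of them. *)
Lemma t_content_finite B f : is_ideal Na B -> (forall i, t_content B f`_i) ->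
  exists2 h, B (phi h) & forall i, content_v h f`_i.
Proof.
move=> idB; elim/poly_ind: f => [|f c IHf] Bf.
  exists 0; first by rewrite polyDK0; case: idB => _ [].
  exact: content_v_coef.
have coefE i : (f * 'X + c%:P)`_i = if i is j.+1 then f`_j else c.
  by rewrite coefD coefMX coefC; case: i => [|i]; rewrite /= ?add0r ?addr0.
have [|h Bh hf] := IHf; first by move=> i; have:= Bf i.+1; rewrite coefE.
have [k Bk kc] : t_content B c by have:= Bf 0%N; rewrite coefE.
have [sh sk] := content_v_join h k.
exists (h + 'X^(size h) * k); first exact: ideal_polyDK_join.
by move=> [|i]; rewrite coefE; [apply: sk | apply: sh].
Qed.

Lemma t_content_t_ideal B : is_ideal Na B -> B <> [set 0] ->
  is_t_ideal (t_content B).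
Proof.
move=> idB nzB; have idJ := t_content_ideal idB.
apply/t_idealP => // [J0|f a /(t_content_finite idB)[h Bh hf] fa].
  apply: nzB; apply/seteqP; split=> [z|_ ->]; last by case: idB => _ [].
  move=> /(nagata_ext_t_content idB)[f [g [Jf _ ->]]].
  have ->: f = 0 by apply/polyP => i; have:= Jf i; rewrite J0 coef0.
  by rewrite polyDK0 mul0r.
by exists h => //; apply: content_v_trans fa.
Qed.

(** A nonunit a <> 0 of D generates a proper nonzero ideal of the Nagata ring:
    an equation a * f = g with g superprimitive would make a divide 1. *)
Lemma maximal_ideal_neq0 M : is_maximal_ideal Na M -> M <> [set 0].
Proof.
move=> [_ maxM] M0; apply: D_not_field => a nza; apply: contrapT => nUa.
pose B := [set z | exists2 w, Na w & z = phi a%:P * w].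
have idNa : is_ideal Na Na by rewrite {2}Na_vE; apply: nagata_ext_ideal.
have [_ [Na0 NaD NaM]] := idNa.
have idB : is_ideal Na B.
  split=> [_ [w Nw ->]|]; first by apply: NaM => //; apply: Na_polyDK.
  split=> [|_ _ [w Nw ->] [w' Nw' ->]|x _ Nx [w Nw ->]].
  - by exists 0; rewrite ?mulr0.
  - by exists (w + w'); [apply: NaD | rewrite mulrDr].
  - by exists (x * w); [apply: NaM | rewrite mulrCA].
have ntB : B <> Na.
  move=> eqB; have: B 1 by rewrite eqB -polyDK1; apply: Na_polyDK.
  case=> w; rewrite Na_vE => -[f [g [_ pg ->]]] /esym eq1.
  have gE : g = a%:P * f.
    apply: polyDK_inj; rewrite polyDKM -[LHS]mul1r -eq1 -mulrA mulfVK //.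
    exact: polyDK_neq0.
  apply: nUa; have [i|q] := pg a 1 nza.
    by rewrite mul1r gE coefCM; exists f`_i.
  by rewrite mulr1 => /esym aq; apply/unitrPr; exists q.
have MB : B = M.
  by apply: maxM => //; rewrite M0 => _ ->; case: idB => _ [].
have: M (phi a%:P).
  by rewrite -MB; exists 1; [rewrite -polyDK1; apply: Na_polyDK | rewrite mulr1].
rewrite M0 => a0; case/negP: nza; apply/eqP.
by apply: (@polyC_inj D); apply: polyDK_inj; rewrite a0 polyDK0.
Qed.

Lemma nagata_ext_neq0 J : is_ideal setT J -> J <> [set 0] ->
  nagata_ext J <> [set 0].
Proof.
move=> idJ nzJ N0; have [y Jy nzy] := ideal_neq0 idJ nzJ.
have: nagata_ext J (phi y%:P).
  apply: nagata_ext_polyDK => i; rewrite coefC.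
  by case: (i == _) => //; case: idJ => _ [].
rewrite N0 => y0; case/negP: nzy; apply/eqP.
by apply: (@polyC_inj D); apply: polyDK_inj; rewrite y0 polyDK0.
Qed.

Lemma nagata_ext_maximal Q : is_maximal_t_ideal Q ->
  is_maximal_ideal Na (nagata_ext Q).
Proof.
move=> [[tQ ntQ] maxQ]; have [idQ nzQ _] := tQ.
split; first by split; [apply: nagata_ext_ideal | apply: nagata_ext_proper].
move=> B [idB ntB] sQB; apply/seteqP; split=> //.
have nzB : B <> [set 0].
  move=> B0; apply: (nagata_ext_neq0 idQ nzQ).
  apply/seteqP; split=> [z /sQB|_ ->]; first by rewrite B0.
  by case: (nagata_ext_ideal idQ) => _ [].
have <-: t_content B = Q; last exact: nagata_ext_t_content.
apply: maxQ; last exact: sub_t_content.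
by split; [apply: t_content_t_ideal | apply: t_content_proper].
Qed.

Lemma maximal_ideal_nagata_ext M : is_maximal_ideal Na M ->
  M = nagata_ext (t_content M).
Proof.
move=> maxM; have nzM := maximal_ideal_neq0 maxM.
have [[idM ntM] topM] := maxM; apply/esym/topM; last exact: nagata_ext_t_content.
split; first exact/nagata_ext_ideal/t_content_ideal.
by apply: nagata_ext_proper; [apply: t_content_t_ideal | apply: t_content_proper].
Qed.

Lemma t_content_maximal M : is_maximal_ideal Na M ->
  is_maximal_t_ideal (t_content M).
Proof.
move=> maxM; have nzM := maximal_ideal_neq0 maxM.
have ME := maximal_ideal_nagata_ext maxM; have [[idM ntM] topM] := maxM.
have tJ := t_content_t_ideal idM nzM; have [idJ _ _] := tJ.
split; first by split=> //; apply: t_content_proper.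
move=> J' [tJ' ntJ'] sJJ'; have [idJ' _ _] := tJ'.
rewrite -(contract_nagata_ext idJ' tJ') -(contract_nagata_ext idJ tJ).
congr contract; rewrite -ME; apply: topM.
  by split; [apply: nagata_ext_ideal | apply: nagata_ext_proper].
by rewrite {1}ME; apply: nagata_extS.
Qed.

End Nagata.

Unset Implicit Arguments.

Theorem corollary3p2 (D : idomainType) (D_not_field : ~ GRing.field_axiom D)
    (Q : set D) (Q_ideal : is_ideal setT Q) :
  is_maximal_t_ideal Q <->
  exists M : set {fraction {poly {fraction D}}},
    is_maximal_ideal (@Na_v D) M /\ Q = contract M.
Proof.
split=> [maxQ|[M [maxM ->]]].
  have [[tQ _] _] := maxQ; exists (nagata_ext Q).
  by split; [apply: nagata_ext_maximal | rewrite contract_nagata_ext].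
have maxJ := t_content_maximal D_not_field maxM.
have [[tJ _] _] := maxJ; have [idJ _ _] := tJ.
by rewrite (maximal_ideal_nagata_ext D_not_field maxM) contract_nagata_ext.
Qed.
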